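(* Let $r\ge2$ be a natural number and $\lambda_1,\ldots,\lambda_r,\alpha_1,\ldots,\alpha_r\in[0,1)$, and put $\mu_2:=\lambda_1+\lambda_2$. Then for any $(s_1,\ldots,s_r)\in U_r$, we have $$\begin{aligned} &e(\lambda_1)\sum_{k\ge-1}(s_1)_k(\alpha_2-\alpha_1)^{k+1}L_{r-1}(\mu_2,\lambda_3,\ldots,\lambda_r;\alpha_2,\ldots,\alpha_r;s_1+s_2+k+1,s_3,\ldots,s_r)\\ &=(1-e(\lambda_1))\,L_r(\lambda_1,\ldots,\lambda_r;\alpha_1,\ldots,\alpha_r;s_1,\ldots,s_r)\\ &\quad+\sum_{k\ge0}(s_1)_k\,L_r(\lambda_1,\ldots,\lambda_r;\alpha_1,\ldots,\alpha_r;s_1+k+1,s_2,\ldots,s_r), \end{aligned}$$ and the series (over $k$) on both sides converge normally on every compact subset of $U_r$.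
   Context: For $r \ge 1$ let $U_r := \{(s_1,\ldots,s_r)\in\mathbb{C}^r \mid \Re(s_1+\cdots+s_i) > i \text{ for all } 1\le i\le r\}$. For real $\lambda_1,\ldots,\lambda_r$, for $\alpha_1,\ldots,\alpha_r\in[0,1)$ and $(s_1,\ldots,s_r)\in U_r$, the multiple Lerch zeta function of depth $r$ is $$L_r(\lambda_1,\ldots,\lambda_r;\alpha_1,\ldots,\alpha_r;s_1,\ldots,s_r) := \sum_{n_1>\cdots>n_r>0}\frac{e(\lambda_1n_1)\cdots e(\lambda_rn_r)}{(n_1+\alpha_1)^{s_1}\cdots(n_r+\alpha_r)^{s_r}},$$ where the $n_i$ are integers and $e(a):=e^{2\pi\iota a}$ for $a\in\mathbb{R}$ (with $\iota=\sqrt{-1}$). The series converges normally on compact subsets of $U_r$. For $s\in\mathbb{C}$: $(s)_{-1}:=1$ and $(s)_k:=\frac{s(s+1)\cdots(s+k)}{(k+1)!}$ for $k\ge0$. The convention $0^0=1$ is used. A family $(f_i)_{i\in I}$ of complex-valued functions on a set $X$ is normally summable on $X$ (equivalently, $\sum_{i \in I} f_i$ converges normally on $X$) if $\|f_i\|_X:=\sup_{x\in X}|f_i(x)|<\infty$ for all $i\in I$ and the family of real numbers $(\|f_i\|_X)_{i\in I}$ is summable. *)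

(* Defs.v *)
From HB Require Import structures.
From mathcomp Require Import all_boot all_order all_algebra finmap.
From mathcomp Require Import complex.
From mathcomp Require Import all_classical all_reals all_analysis.

Set Implicit Arguments.
Unset Strict Implicit.
Unset Printing Implicit Defensive.
Import Order.TTheory GRing.Theory Num.Theory.
Import numFieldNormedType.Exports.

Local Open Scope classical_set_scope.
Local Open Scope ring_scope.
Local Open Scope complex_scope.

(* R[i] with the topology of its modulus, as the library does for the abstract
   number fields. *)
HB.instance Definition _ (R : realType) := NormedModule.copy R[i] R[i]^o.

Section Sums.
Variable R : realType.

(* Unordered summation: the limit of the sums over finite subsets of D along
   the filter of finite sets directed by inclusion. *)
Definition fset_filter (I : choiceType) : set_system {fset I} :=
  filter_from [set: {fset I}] (fun A => [set B : {fset I} | (A `<=` B)%fset]).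

Definition family_sum (I : choiceType) (D : set I) (f : I -> R[i]) : R[i] :=
  lim ((fun B : {fset I} => \sum_(x <- B | x \in D) f x) @ @fset_filter I).

(* On the empty set the supremum is 0, since [sup set0 = 0]. *)
Definition sup_norm (T : Type) (X : set T) (f : T -> R[i]) : R :=
  sup [set complex.Re `|f x| | x in X].

Definition normally_summable (I : choiceType) (T : Type) (X : set T)
    (f : I -> T -> R[i]) : Prop :=
  (forall i, has_ubound [set complex.Re `|f i x| | x in X]) /\
  summable [set: I] (fun i => (sup_norm X (f i))%:E).

End Sums.

Section Lerch.
Variable R : realType.

Definition cexp (z : R[i]) : R[i] :=
  (expR (complex.Re z) * cos (complex.Im z))
    +i* (expR (complex.Re z) * sin (complex.Im z)).

Definition e (a : R) : R[i] := cexp (0 +i* (2 * pi * a)).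

(* Meaningful for x > 0, with the real logarithm of x. *)
Definition cpow (x : R) (s : R[i]) : R[i] := cexp (s * (ln x)%:C).

(* (s)_k, for k >= -1 only. *)
Definition poch (s : R[i]) (k : int) : R[i] :=
  match k with
  | Posz k => (\prod_(j < k.+1) (s + j%:R)) / (k.+1)`!%:R
  | Negz _ => 1
  end.

(* Coordinates are numbered from 0, hence the bound i.+1. *)
Definition lerch_domain (r : nat) : set 'rV[R[i]]_r :=
  [set s | forall i : 'I_r,
    (i.+1)%:R < complex.Re (\sum_(j < r | (j <= i)%N) s ord0 j)].

Definition decreasing_indices (r : nat) : set {ffun 'I_r -> nat} :=
  [set n | (forall i j : 'I_r, (i < j)%N -> (n j < n i)%N) /\
           (forall i : 'I_r, (0 < n i)%N)].

Arguments decreasing_indices r : clear implicits.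

Definition lerch (r : nat) (lam alp : 'rV[R]_r) (s : 'rV[R[i]]_r) : R[i] :=
  family_sum (decreasing_indices r) (fun n : {ffun 'I_r -> nat} =>
    (\prod_(i < r) e (lam ord0 i * (n i)%:R)) /
    (\prod_(i < r) cpow ((n i)%:R + alp ord0 i) (s ord0 i))).

End Lerch.

Arguments lerch_domain {R} r.

Section Rows.
Variable V : zmodType.

(* (v_1, v_2, v_3, ...) |-> (v_1 + v_2, v_3, ...) *)
Definition merge_head (n : nat) (v : 'rV[V]_n.+2) : 'rV[V]_n.+1 :=
  \row_i (if i == ord0 then v ord0 ord0 + v ord0 (lift ord0 ord0)
          else v ord0 (lift ord0 i)).

(* (v_1, v_2, ...) |-> (v_2, ...) *)
Definition drop_head (n : nat) (v : 'rV[V]_n.+2) : 'rV[V]_n.+1 :=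
  \row_i v ord0 (lift ord0 i).

(* (v_1, v_2, ...) |-> (v_1 + z, v_2, ...) *)
Definition shift_head (n : nat) (z : V) (v : 'rV[V]_n.+1) : 'rV[V]_n.+1 :=
  \row_i (if i == ord0 then v ord0 i + z else v ord0 i).

End Rows.

Section Terms.
Variables (R : realType) (n : nat) (lam alp : 'rV[R]_n.+2).

(* The term of index k = m - 1 of the series over k >= -1. *)
Definition lhs_term (m : nat) (s : 'rV[R[i]]_n.+2) : R[i] :=
  poch (s ord0 ord0) (m%:Z - 1)
  * (((alp ord0 (lift ord0 ord0) - alp ord0 ord0) ^+ m)%:C)
  * lerch (merge_head lam) (drop_head alp) (shift_head m%:R (merge_head s)).

Definition rhs_term (k : nat) (s : 'rV[R[i]]_n.+2) : R[i] :=
  poch (s ord0 ord0) k%:Z * lerch lam alp (shift_head (k.+1)%:R s).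

End Terms.

(* Main.v *)
(* By the binomial series, sum_(k >= 0) (s)_k x^(-s-k-1) = (x - 1)^(-s) - x^(-s) for x > 1.
   Applied to x = n_1 + alpha_1 this turns the series on the right into
     sum_n A(n) - L_r,  A(n) = e(lambda_1 n_1) (n_1 - 1 + alpha_1)^(-s_1) * (factors i >= 2).
   The terms of A with n_1 > n_2 + 1 become e(lambda_1) L_r after the shift n_1 -> n_1 + 1.
   Those with n_1 = n_2 + 1 carry the factor (n_2 + alpha_1)^(-s_1), whose binomial expansion
   around n_2 + alpha_2 gives the series on the left.
   Everything converges because, by Abel summation on the exponents, the terms of L_r are
   dominated by prod_i n_i^(-1-eta) on the set where Re(s_1 + ... + s_i) >= i + eps for all i. *)

Require Import Defs.
From mathcomp Require Import all_boot all_order all_algebra finmap.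
From mathcomp Require Import complex.
From mathcomp Require Import all_classical all_reals all_analysis.
From mathcomp Require Import ring lra.
Set Implicit Arguments.
Unset Strict Implicit.
Unset Printing Implicit Defensive.
Import Order.TTheory GRing.Theory Num.Theory.
Import numFieldNormedType.Exports.
Local Open Scope classical_set_scope.
Local Open Scope ring_scope.

Import ComplexField.Normc.
Local Open Scope complex_scope.

(** Both series over k have one shape: a binomial coefficient of s_1 times the sum over n of t(n)
    y(n)^m, where t(n) is a Lerch term and y(n) is a constant c divided by the head base. On the
    right the base is n_1 + alpha_1 and c = 1, so y(n) <= 1/2, because depth at least 2 forces n_1
    >= 2. On the left the base is n_2 + alpha_2 and c = alpha_2 - alpha_1, so |y(n)| <= |c| < 1. A
    bound delta < 1 on |y(n)| that is uniform in n serves twice: it allows the sums over k and n to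
    be exchanged, and it gives the normal convergence. For |s_1| <= N with N a natural number, the
    coefficients are dominated by those of (1 - x)^(-N), whose partial sums at delta are at most (1
    - delta)^(-N). [family_sum] and [limn] are total and return a value even without convergence, so
    the work is done on actual convergence statements and translated only at the end. The sum of A
    is computed twice, from the series on the right and from the splitting of the indices;
    uniqueness of the limit gives the formula. *)

Arguments decreasing_indices r : clear implicits.

(** * Convergence in R[i] through the real-valued modulus *)

Section Modulus.
Variable R : realType.
Implicit Types z : R[i].

Lemma normc_ge0 z : 0 <= normc z.
Proof. by case: z => a b; exact: sqrtr_ge0. Qed.

Lemma normc_real (x : R) : normc x%:C = `|x|.
Proof. by rewrite /= expr0n addr0 sqrtr_sqr. Qed.

Lemma normc_Re z : `|complex.Re z| <= normc z.
Proof.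
case: z => a b /=; rewrite -sqrtr_sqr.
by apply: ler_wsqrtr; rewrite lerDl sqr_ge0.
Qed.

Lemma normc_Im z : `|complex.Im z| <= normc z.
Proof.
case: z => a b /=; rewrite -sqrtr_sqr.
by apply: ler_wsqrtr; rewrite lerDr sqr_ge0.
Qed.

Lemma normc_le z : normc z <= `|complex.Re z| + `|complex.Im z|.
Proof.
rewrite {1}[z]complexE; apply: le_trans (le_normcD _ _) _.
by rewrite normcM !normc_real /= expr0n expr1n add0r sqrtr1 mul1r.
Qed.

Lemma normc_sum (I : Type) (r : seq I) (P : pred I) (f : I -> R[i]) :
  normc (\sum_(i <- r | P i) f i) <= \sum_(i <- r | P i) normc (f i).
Proof.
elim/big_ind2: _ => [|x a y b xa yb|//]; first by rewrite normc0.
exact: le_trans (le_normcD _ _) (lerD xa yb).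
Qed.

Lemma normcX z m : normc (z ^+ m) = normc z ^+ m.
Proof. by elim: m => [|m IH]; rewrite ?expr0 ?normc1 // !exprS normcM IH. Qed.

Lemma normc_nat m : normc (m%:R : R[i]) = m%:R.
Proof. by rewrite -(rmorph_nat (real_complex R)) normc_real normr_nat. Qed.

Lemma normcB_sym z w : normc (z - w) = normc (w - z).
Proof. by rewrite -opprB normcN. Qed.

(** The norm of [R[i]] takes its values in [R[i]], so epsilon is a complex number there; being
    positive, it has imaginary part 0 and can be replaced by a real one. *)
Lemma cvg_normcP (T : Type) (F : set_system T) {FF : Filter F} (f : T -> R[i])
    (l : R[i]) :
  f @ F --> l <->
  forall eps : R, 0 < eps -> \forall x \near F, normc (l - f x) < eps.
Proof.
split.
  move=> /cvgrPdist_lt h eps e0.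
  have e0' : 0 < eps%:C :> R[i] by rewrite ltcR.
  by apply: filterS (h _ e0') => x; rewrite ltcR.
move=> h; apply/cvgrPdist_lt => -[er ei].
rewrite ltcE /= => /andP[/eqP -> e0].
by apply: filterS (h _ e0) => x; rewrite -ltcR.
Qed.

Lemma cvg_Re (T : Type) (F : set_system T) {FF : Filter F} (u : T -> R[i]) l :
  u @ F --> l -> (fun k => complex.Re (u k)) @ F --> complex.Re l.
Proof.
move=> /cvg_normcP ul; apply/cvgrPdist_lt => eps e0.
apply: filterS (ul _ e0) => k; apply: le_lt_trans.
by rewrite -[X in `|X|](raddfB (@complex.Re R)) normc_Re.
Qed.

Lemma cvg_normc (T : Type) (F : set_system T) {FF : Filter F} (u : T -> R[i]) l :
  u @ F --> l -> (fun k => normc (u k)) @ F --> normc l.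
Proof.
move=> /cvg_normcP ul; apply/cvgrPdist_lt => eps e0.
apply: filterS (ul _ e0) => k; apply: le_lt_trans.
have h1 := le_normcD (l - u k) (u k); have h2 := le_normcD (u k - l) l.
move: h1 h2; rewrite !subrK [normc (u k - l)]normcB_sym.
by rewrite ler_norml => h1 h2; apply/andP; split; lra.
Qed.

Lemma cvg_Re_Im (u : nat -> R[i]) l :
  (fun k => complex.Re (u k)) @ \oo --> complex.Re l ->
  (fun k => complex.Im (u k)) @ \oo --> complex.Im l -> u @ \oo --> l.
Proof.
move=> /cvgrPdist_lt hr /cvgrPdist_lt hi; apply/cvg_normcP => eps e0.
have e2 : 0 < eps / 2 by rewrite divr_gt0.
apply: filterS2 (hr _ e2) (hi _ e2) => k; rewrite -!raddfB.
by have := normc_le (l - u k); lra.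
Qed.

Lemma seq_cvg_unique (u : nat -> R[i]) (a b : R[i]) :
  u @ \oo --> a -> u @ \oo --> b -> a = b.
Proof. exact: (cvg_unique (@norm_hausdorff _ R[i])). Qed.

End Modulus.

(** * Unordered sums *)

Section FamilySums.
Variables (R : realType).

Global Instance fset_filter_proper (I : choiceType) : ProperFilter (@fset_filter I).
Proof.
apply: filter_from_proper; last by move=> A _; exists A; rewrite /= fsubset_refl.
apply: filter_from_filter; first by exists fset0.
move=> A B _ _; exists (A `|` B)%fset => // C /=.
by rewrite fsubUset => /andP[].
Qed.

Definition has_family_sum (I : choiceType) (D : set I) (f : I -> R[i]) (l : R[i]) :=
  (fun B : {fset I} => \sum_(x <- B | x \in D) f x) @ @fset_filter I --> l.

Definition sums_bounded (I : choiceType) (D : set I) (g : I -> R) (G : R) :=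
  forall B : {fset I}, \sum_(x <- B | x \in D) g x <= G.

Lemma ler_sum_fsubset (I : choiceType) (D : set I) (g : I -> R) (A B : {fset I}) :
  (forall x, D x -> 0 <= g x) -> (A `<=` B)%fset ->
  \sum_(x <- A | x \in D) g x <= \sum_(x <- B | x \in D) g x.
Proof.
move=> g0 AB; rewrite big_mkcond [leRHS]big_mkcond /=.
rewrite [leRHS](big_fsetID _ (fun x => x \in A)) /=.
rewrite (_ : [fset x in B | x \in A]%fset = A); last first.
  apply/fsetP => x; rewrite !inE /=; apply/andP/idP => [[]//|xA].
  by split=> //; exact: (fsubsetP AB).
rewrite lerDl; apply: sumr_ge0 => x _.
by case: ifPn => // /set_mem /g0.
Qed.

Section OneIndexType.
Variables (I : choiceType) (D : set I).
Implicit Types (f : I -> R[i]) (g : I -> R).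

Lemma has_family_sumP f l : has_family_sum D f l <->
  forall eps : R, 0 < eps -> exists A : {fset I}, forall B : {fset I},
    (A `<=` B)%fset -> normc (l - \sum_(x <- B | x \in D) f x) < eps.
Proof.
rewrite /has_family_sum cvg_normcP; split=> h eps /h.
  by case=> A _ AP; exists A => B /AP.
by case=> A AP; exists A.
Qed.

Lemma family_sumE f l : has_family_sum D f l -> family_sum D f = l.
Proof. by move=> h; apply: cvg_lim h; exact: norm_hausdorff. Qed.

Lemma eq_has_family_sum f f' l : {in D, f =1 f'} ->
  has_family_sum D f l -> has_family_sum D f' l.
Proof.
move=> ff'; rewrite /has_family_sum.
by under eq_fun do rewrite (eq_bigr _ ff').
Qed.

Lemma has_family_sumD f f' l l' : has_family_sum D f l -> has_family_sum D f' l' ->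
  has_family_sum D (fun x => f x + f' x) (l + l').
Proof.
move=> h h'; rewrite /has_family_sum; under eq_fun do rewrite big_split.
exact: (cvgD h h').
Qed.

Lemma has_family_sumMl c f l : has_family_sum D f l ->
  has_family_sum D (fun x => c * f x) (c * l).
Proof.
move=> h; rewrite /has_family_sum; under eq_fun do rewrite -mulr_sumr.
exact: (cvgM (cvg_cst _) h).
Qed.

Arguments has_family_sumMl c {f l} _.

Lemma has_family_sum_sum (f : nat -> I -> R[i]) (l : nat -> R[i]) (c : nat -> R[i]) K :
  (forall m, has_family_sum D (f m) (l m)) ->
  has_family_sum D (fun x => \sum_(0 <= m < K) c m * f m x)
    (\sum_(0 <= m < K) c m * l m).
Proof.
move=> h; elim: K => [|K IH].
  rewrite big_nil; apply/has_family_sumP => eps e0; exists fset0 => B _.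
  by rewrite big1 ?subr0 ?normc0 // => x _; rewrite big_nil.
rewrite (_ : \sum_(0 <= m < K.+1) c m * l m =
    \sum_(0 <= m < K) c m * l m + c K * l K); last by rewrite big_nat_recr.
refine (eq_has_family_sum _ (has_family_sumD IH (has_family_sumMl (c K) (h K)))).
by move=> x _; rewrite big_nat_recr.
Qed.

Lemma has_family_sum_le f g G l :
  (forall x, D x -> normc (f x) <= g x) -> sums_bounded D g G ->
  has_family_sum D f l -> normc l <= G.
Proof.
move=> fg gG /has_family_sumP h; apply/ler_addgt0Pl => eps /h[A /(_ A)].
rewrite fsubset_refl => /(_ isT) hA.
rewrite -(subrK (\sum_(x <- A | x \in D) f x) l).
apply: le_trans (le_normcD _ _) _; apply: lerD (ltW hA) _.
apply: le_trans (normc_sum _ _ _) _; apply: le_trans (gG A).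
by apply: ler_sum => x; rewrite inE => /fg.
Qed.

Lemma has_family_sum_ge0 g G : (forall x, D x -> 0 <= g x) -> sums_bounded D g G ->
  exists l, has_family_sum D (fun x => (g x)%:C) l.
Proof.
move=> g0 gG; pose S := [set \sum_(x <- B | x \in D) g x | B in [set: {fset I}]].
have supS : has_sup S.
  split; first by exists (\sum_(x <- fset0 | x \in D) g x); exists fset0.
  by exists G => _ [B _ <-]; exact: gG.
exists (sup S)%:C; apply/has_family_sumP => eps e0.
have [_ [A _ <-] SA] := sup_adherent e0 supS; exists A => B AB.
rewrite -rmorph_sum -rmorphB normc_real /= ger0_norm; last first.
  by rewrite subr_ge0; apply: ub_le_sup; [exact: supS.2|exists B].
rewrite ltrBlDr -ltrBlDl; apply: lt_le_trans SA _.
exact: ler_sum_fsubset.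
Qed.

(** Reduction to nonnegative families: f = (|f| + Re f) + i (|f| + Im f) - (1 + i) |f|, and each of
    the three real families lies between 0 and 2 g. *)
Lemma has_family_sum_dominated f g G :
  (forall x, D x -> normc (f x) <= g x) -> sums_bounded D g G ->
  exists l, has_family_sum D f l.
Proof.
move=> fg gG.
have bnd h : (forall x, D x -> h x <= 2 * g x) -> sums_bounded D h (2 * G).
  move=> hg B; apply: (@le_trans _ _ (2 * \sum_(x <- B | x \in D) g x)).
    by rewrite mulr_sumr; apply: ler_sum => x; rewrite inE => /hg.
  by rewrite ler_pM2l.
have [||a ha] := @has_family_sum_ge0 (fun x => normc (f x) + complex.Re (f x)) (2 * G).
- by move=> x _; have := normc_Re (f x); rewrite ler_norml => /andP[]; lra.
- by apply: bnd => x /fg; have := normc_Re (f x); rewrite ler_norml => /andP[]; lra.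
have [||b hb] := @has_family_sum_ge0 (fun x => normc (f x) + complex.Im (f x)) (2 * G).
- by move=> x _; have := normc_Im (f x); rewrite ler_norml => /andP[]; lra.
- by apply: bnd => x /fg; have := normc_Im (f x); rewrite ler_norml => /andP[]; lra.
have [||c hc] := @has_family_sum_ge0 (fun x => normc (f x)) (2 * G).
- by move=> x _; exact: normc_ge0.
- by apply: bnd => x /fg; have := normc_ge0 (f x); lra.
exists (a + 'i * b + (- (1 + 'i)) * c).
refine (eq_has_family_sum _ (has_family_sumD (has_family_sumD ha
  (has_family_sumMl 'i hb)) (has_family_sumMl (- (1 + 'i)) hc))).
move=> x _; rewrite [RHS]complexE complexiE !rmorphD /=; ring.
Qed.

End OneIndexType.

Arguments has_family_sumMl {I D} c {f l} _.

Lemma has_family_sumU (I : choiceType) (D E : set I) f l l' :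
  (forall x, D x -> ~ E x) -> has_family_sum D f l -> has_family_sum E f l' ->
  has_family_sum (D `|` E) f (l + l').
Proof.
move=> DE h h'; rewrite /has_family_sum.
have -> : (fun B : {fset I} => \sum_(x <- B | x \in D `|` E) f x) =
    (fun B : {fset I} => \sum_(x <- B | x \in D) f x + \sum_(x <- B | x \in E) f x).
  2: exact: (cvgD h h').
apply/funext => B.
rewrite big_mkcond [X in _ = X + _]big_mkcond [X in _ = _ + X]big_mkcond -big_split.
apply: eq_bigr => x _ /=; rewrite in_setU.
case: (boolP (x \in D)) => xD; case: (boolP (x \in E)) => xE /=;
  rewrite ?addr0 ?add0r //.
by move/set_mem: xD => /DE; move/set_mem: xE.
Qed.

Lemma has_family_sum_reindex (I J : choiceType) (D : set I) (E : set J)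
    (h : I -> J) (h' : J -> I) f l :
  (forall x, D x -> E (h x) /\ h' (h x) = x) ->
  (forall y, E y -> D (h' y) /\ h (h' y) = y) ->
  has_family_sum D (f \o h) l -> has_family_sum E f l.
Proof.
move=> hP h'P /has_family_sumP H; apply/has_family_sumP => eps /H[A AP].
exists (h @` [fset x in A | x \in D])%fset => B AB.
(* [C] must contain [A] for the hypothesis to apply. Adding [A] does no harm: its points in [D]
   already come from [B], so the trace of [C] on [D] is exactly the image of the trace of [B] on
   [E]. *)
pose C := (A `|` (h' @` [fset y in B | y \in E]))%fset.
have := AP C (fsubsetUl _ _); congr (normc (l - _) < eps).
rewrite [LHS]big_fset_condE [RHS]big_fset_condE /=.
have -> : [fset x in C | x \in D]%fset = (h' @` [fset y in B | y \in E])%fset.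
  apply/fsetP => x; rewrite !inE /=; apply/andP/idP.
    case=> /orP[xA xD|//]; apply/imfsetP; exists (h x); last first.
      by have [_ ->] := hP _ (set_mem xD).
    rewrite !inE /= (fsubsetP AB) //=; last first.
      by apply/imfsetP; exists x => //; rewrite !inE /= xA.
    by apply: mem_set; have [] := hP _ (set_mem xD).
  move=> xB; split; first by rewrite xB orbT.
  case/imfsetP: xB => y; rewrite !inE /= => /andP[_ yE] ->.
  by have [] := h'P _ (set_mem yE).
rewrite big_imfset /=; last first.
  move=> y z; rewrite !inE /= => /andP[_ /set_mem/h'P[_ yE]].
  by move=> /andP[_ /set_mem/h'P[_ zE]] /(congr1 h); rewrite yE zE.
rewrite big_seq [RHS]big_seq; apply: eq_bigr => y.
by rewrite !inE /= => /andP[_ /set_mem/h'P[_ ->]].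
Qed.

Lemma nonneg_series_cvg (u : nat -> R) (U : R) : (forall m, 0 <= u m) ->
  (forall K, \sum_(0 <= m < K) u m <= U) -> cvgn (series u).
Proof.
move=> u0 uU; apply: nondecreasing_is_cvgn.
  by apply/nondecreasing_seqP => k; rewrite seriesSr lerDl.
by exists U => _ [K _ <-]; exact: uU.
Qed.

(* The domination by a product q m * g x makes the partial sums over m converge
   uniformly in x, so no Fubini theorem for double families is needed. *)
Lemma exchange_series_family_sum (I : choiceType) (D : set I) (t F : I -> R[i])
    (g y : I -> R) (delta G U : R) (p : nat -> R[i]) (q : nat -> R) (l : nat -> R[i]) :
  sums_bounded D g G -> (forall x, D x -> normc (t x) <= g x) ->
  (forall x, D x -> `|y x| <= delta) -> (forall m, normc (p m) <= q m) ->
  (forall K, \sum_(0 <= m < K) q m * delta ^+ m <= U) ->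
  (forall x, D x -> [series p m * (y x)%:C ^+ m]_m @ \oo --> F x) ->
  (forall m, has_family_sum D (fun x => t x * (y x)%:C ^+ m) (l m)) ->
  exists2 L, has_family_sum D (fun x => t x * F x) L &
    [series p m * l m]_m @ \oo --> L.
Proof.
move=> gG tg yd pq qU pF hl.
(* The sign of [delta] is known only through a point of [D], so the empty index set is settled
   apart; all its sums are 0. *)
have [D0|/set0P[x0 Dx0]] := eqVneq D set0.
  have s0 f k : has_family_sum D f k -> k = 0.
    move=> h; apply: eq0_normc; apply/eqP; rewrite eq_le normc_ge0 andbT.
    apply: (@has_family_sum_le _ D f (fun=> 0) 0) h; first by rewrite D0.
    by move=> B; rewrite big1.
  exists 0; first last.
    rewrite (_ : [series _]_m = fun=> 0); first exact: cvg_cst.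
    apply/funext => K; rewrite /series /=; apply: big1 => m _.
    by rewrite (s0 _ _ (hl m)) mulr0.
  have [k hk] : exists k, has_family_sum D (fun x => t x * F x) k.
    apply: (@has_family_sum_dominated _ D _ (fun=> 0) 0); first by rewrite D0.
    by move=> B; rewrite big1.
  by move: (hk); rewrite (s0 _ _ hk).
have d0 : 0 <= delta by apply: le_trans (yd _ Dx0).
have q0 m : 0 <= q m by apply: le_trans (pq m); exact: normc_ge0.
pose Q := [series q m * delta ^+ m]_m; pose T := limn Q.
have cQ : cvgn Q by apply: nonneg_series_cvg qU => m; rewrite mulr_ge0 ?exprn_ge0.
have QT K : Q K <= T.
  apply: nondecreasing_cvgn_le cQ K.
  by apply/nondecreasing_seqP => k; rewrite /Q seriesSr lerDl mulr_ge0 ?exprn_ge0.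
(* The remainder bound does not depend on x: it is the tail of the majorant series. The limit [F x]
   is reached through a partial sum of some length [J >= K]. *)
have rem x K : D x ->
    normc (F x - \sum_(0 <= m < K) p m * (y x)%:C ^+ m) <= T - Q K.
  move=> Dx; apply/ler_addgt0Pl => eps e0.
  have /cvg_normcP/(_ _ e0) [N _ NP] := pF x Dx.
  pose J := maxn N K; have {NP} := NP J (leq_maxl _ _).
  set SJ := series _ _ => hJ.
  rewrite -(subrK SJ (F x)) -addrA; apply: le_trans (le_normcD _ _) _.
  apply: lerD; first exact: ltW.
  apply: (@le_trans _ _ (Q J - Q K)); last by rewrite lerB.
  have KJ : (K <= J)%N := leq_maxr N K.
  have -> : Q J - Q K = \sum_(K <= m < J) q m * delta ^+ m by exact: sub_series_geq.
  have -> : SJ - \sum_(0 <= m < K) p m * (y x)%:C ^+ m =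
      \sum_(K <= m < J) p m * (y x)%:C ^+ m by exact: sub_series_geq.
  apply: le_trans (normc_sum _ _ _) _; apply: ler_sum => m _.
  rewrite normcM normcX normc_real; apply: ler_pM => //; first exact: normc_ge0.
  by rewrite lerXn2r ?nnegrE //; exact: yd.
have bnd (c : R) : 0 <= c -> sums_bounded D (fun x => g x * c) (G * c).
  by move=> c0 B; rewrite -mulr_suml ler_wpM2r.
have T0 K : 0 <= T - Q K by rewrite subr_ge0.
have [L hL] : exists L, has_family_sum D (fun x => t x * F x) L.
  apply: (@has_family_sum_dominated _ D _ (fun x => g x * (T - Q 0%N)) _ _ (bnd _ (T0 _))).
  move=> x Dx; rewrite normcM; apply: ler_pM; rewrite ?normc_ge0 ?tg //.
  by have := rem x 0%N Dx; rewrite big_nil subr0.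
exists L => //; apply/cvg_normcP => eps e0.
have /cvgrPdist_lt cQ' : G * (T - Q k) @[k --> \oo] --> G * (T - T).
  by apply: cvgMr; apply: cvgB cQ; exact: cvg_cst.
apply: filterS (cQ' _ e0) => K; rewrite subrr mulr0 sub0r normrN; apply: le_lt_trans.
apply: le_trans (ler_norm _).
have := has_family_sumD hL (has_family_sumMl (-1) (@has_family_sum_sum _ _ _ _ p K hl)).
rewrite mulN1r; apply: has_family_sum_le (bnd _ (T0 K)) => x Dx.
rewrite (_ : _ + _ = t x * (F x - \sum_(0 <= m < K) p m * (y x)%:C ^+ m)).
  by rewrite normcM ler_pM ?normc_ge0 ?tg ?rem.
rewrite mulrBr mulN1r mulr_sumr; congr (_ - _); apply: eq_bigr => m _.
by rewrite mulrCA.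
Qed.

End FamilySums.

Arguments has_family_sumMl {R I D} c {f l} _.

(** * The binomial series *)

Section ComplexExponential.
Variable R : realType.
Implicit Types z w : R[i].

Lemma cexpD z w : cexp (z + w) = cexp z * cexp w.
Proof.
case: z w => a b [c d]; rewrite /cexp /= expRD cosD sinD.
by apply/eqP; rewrite eq_complex /=; apply/andP; split; apply/eqP; ring.
Qed.

Lemma cexp_real (x : R) : cexp x%:C = (expR x)%:C.
Proof. by rewrite /cexp /= cos0 sin0 mulr1 mulr0. Qed.

Lemma cexp0 : cexp 0 = 1 :> R[i].
Proof. by rewrite (cexp_real 0) expR0. Qed.

Lemma cexpN z : cexp (- z) = (cexp z)^-1.
Proof.
apply: divr1_eq; rewrite invrK.
by rewrite -cexpD addNr cexp0.
Qed.

Lemma normc_cexp z : normc (cexp z) = expR (complex.Re z).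
Proof.
rewrite /cexp /= !exprMn -mulrDr cos2Dsin2 mulr1 sqrtr_sqr.
by rewrite ger0_norm // expR_ge0.
Qed.

Lemma eD (a b : R) : e (a + b) = e a * e b.
Proof. by rewrite /e mulrDr -cexpD; congr cexp; simpc. Qed.

Lemma normc_e (a : R) : normc (e a) = 1.
Proof. by rewrite /e normc_cexp expR0. Qed.

Lemma cpowD (x : R) z w : cpow x (z + w) = cpow x z * cpow x w.
Proof. by rewrite /cpow mulrDl cexpD. Qed.

Lemma cpow_nat (x : R) m : 0 < x -> cpow x (m%:R : R[i]) = x%:C ^+ m.
Proof.
move=> x0; rewrite /cpow -(rmorph_nat (real_complex R)) -rmorphM cexp_real.
by rewrite mulrC expRM_natr lnK // rmorphXn.
Qed.

Lemma normc_cpow (x : R) z : 0 < x -> normc (cpow x z) = x `^ complex.Re z.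
Proof.
move=> x0; rewrite /cpow normc_cexp /powR gt_eqF //; congr expR.
by case: z => a b /=; rewrite mulr0 subr0.
Qed.

End ComplexExponential.

Section BinomialCoefficients.

(* The coefficient of x^m in (1 - x)^(-s), i.e. (s)_(m-1) in the notation of [poch]. *)
Definition binc (K : fieldType) (s : K) (m : nat) : K :=
  (\prod_(j < m) (s + j%:R)) / m`!%:R.

Lemma poch_binc (R : realType) (s : R[i]) m : poch s (m%:Z - 1) = binc s m.
Proof.
case: m => [|m]; first by rewrite /binc big_ord0 fact0 divr1.
by rewrite (_ : m.+1%:Z - 1 = m) // -addn1 PoszD addrK.
Qed.

Variable K : numFieldType.
Implicit Type s : K.

Lemma binc0 s : binc s 0 = 1.
Proof. by rewrite /binc big_ord0 fact0 divr1. Qed.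

Lemma bincS s m : m.+1%:R * binc s m.+1 = (s + m%:R) * binc s m.
Proof.
rewrite /binc big_ord_recr /= factS natrM.
have : (m.+1%:R : K) != 0 by rewrite pnatr_eq0.
have : (m`!%:R : K) != 0 by rewrite pnatr_eq0 -lt0n fact_gt0.
by move: (m`!%:R : K) (m.+1%:R : K) => a b a0 b0; field; rewrite a0.
Qed.

Lemma bincS_shift s m : m.+1%:R * binc s m.+1 = s * binc (s + 1) m.
Proof.
rewrite /binc big_ord_recl /= addr0 factS natrM.
have -> : \prod_(i < m) (s + (bump 0 i)%:R) = \prod_(i < m) (s + 1 + i%:R).
  by apply: eq_bigr => i _; rewrite /bump /= -addrA nat1r.
have : (m.+1%:R : K) != 0 by rewrite pnatr_eq0.
have : (m`!%:R : K) != 0 by rewrite pnatr_eq0 -lt0n fact_gt0.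
by move: (m`!%:R : K) (m.+1%:R : K) => a b a0 b0; field; rewrite a0.
Qed.

Lemma binc_pascal s m : binc s m.+1 = binc (s + 1) m.+1 - binc (s + 1) m.
Proof.
have m0 : (m.+1%:R : K) != 0 by rewrite pnatr_eq0.
apply: (mulfI m0); rewrite mulrBr bincS_shift bincS -nat1r; ring.
Qed.

(** Exact truncated form of (1 - x)^(-s) = (1 - x) (1 - x)^(-s-1); the two sums on the right have
    lengths k + 1 and k because of the factor x. *)
Lemma series_binc s x k :
  \sum_(0 <= m < k.+1) binc s m * x ^+ m =
  \sum_(0 <= m < k.+1) binc (s + 1) m * x ^+ m -
  x * \sum_(0 <= m < k) binc (s + 1) m * x ^+ m.
Proof.
rewrite big_nat_recl // [in RHS]big_nat_recl //= !binc0 mulr_sumr -addrA -sumrB; congr (_ + _).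
by apply: eq_bigr => m _; rewrite binc_pascal exprS; ring.
Qed.

Lemma binc_ge0 s m : 0 <= s -> 0 <= binc s m.
Proof.
by move=> s0; rewrite divr_ge0 // prodr_ge0 // => i _; rewrite addr_ge0.
Qed.

End BinomialCoefficients.

Section BinomialSeries.
Variable R : realType.

Lemma normc_binc (s : R[i]) (M : R) m : normc s <= M -> normc (binc s m) <= binc M m.
Proof.
move=> sM; rewrite /binc normcM normcV normc_nat.
rewrite ler_wpM2r ?invr_ge0 //.
elim: m => [|m IH]; first by rewrite !big_ord0 normc1.
rewrite !big_ord_recr /= normcM; apply: ler_pM; rewrite ?normc_ge0 //.
by apply: le_trans (le_normcD _ _) _; rewrite normc_nat lerD2r.
Qed.

(** With a natural exponent, induction replaces the binomial theorem: by [series_binc], 1 - x times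
    the partial sum for N + 1 is at most the partial sum for N. *)
Lemma binc_sum_le (x : R) N k : 0 <= x < 1 ->
  \sum_(0 <= m < k) binc (N%:R : R) m * x ^+ m <= (1 - x) ^- N.
Proof.
move=> /andP[x0 x1]; elim: N k => [|N IH] k.
  rewrite expr0 invr1; case: k => [|k]; first by rewrite big_nil.
  rewrite big_nat_recl //= binc0 mulr1 big1 ?addr0 // => m _.
  by rewrite /binc big_ord_recl /= !(addr0, mul0r).
have d0 : 0 < 1 - x by rewrite subr_gt0.
rewrite exprS invfM mulrC ler_pdivlMr //.
apply: le_trans (IH k); case: k => [|k]; first by rewrite !big_nil mul0r.
rewrite (series_binc N%:R) natr1 mulrBr mulr1 [_ * x]mulrC lerB // ler_wpM2l //.
by rewrite big_nat_recr //= lerDl mulr_ge0 ?exprn_ge0 // binc_ge0.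
Qed.

Lemma binc_abs_cvg (k s : R[i]) (x : R) : `|x| < 1 -> exists U : R, forall K,
  \sum_(0 <= m < K) normc (k * binc s m) * `|x| ^+ m <= U.
Proof.
move=> x1; pose N := (Num.truncn (normc s)).+1.
exists (normc k * (1 - `|x|) ^- N) => K.
apply: le_trans (ler_wpM2l (normc_ge0 k) (@binc_sum_le `|x| N K _)); last first.
  by rewrite normr_ge0.
rewrite mulr_sumr; apply: ler_sum => m _; rewrite normcM -mulrA.
rewrite ler_wpM2l ?normc_ge0 // ler_wpM2r ?exprn_ge0 // normc_binc //.
exact/ltW/truncnS_gt.
Qed.

Lemma pseries_cvg (c : nat -> R) (k s : R[i]) (x : R) : `|x| < 1 ->
  (forall m, `|c m| <= normc (k * binc s m)) -> cvgn (pseries c x).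
Proof.
move=> x1 cb; have [U hU] := binc_abs_cvg k s x1.
apply: normed_cvg; apply: (@nonneg_series_cvg _ _ U) => //= K.
apply: le_trans (hU K); apply: ler_sum => m _.
by rewrite normrM normrX ler_wpM2r ?exprn_ge0.
Qed.

Lemma Re_binc_cvg (k s : R[i]) (x : R) : `|x| < 1 ->
  cvgn (pseries (fun m => complex.Re (k * binc s m)) x).
Proof. by move=> x1; apply: pseries_cvg x1 _ => m; exact: normc_Re. Qed.

Lemma Im_binc_cvg (k s : R[i]) (x : R) : `|x| < 1 ->
  cvgn (pseries (fun m => complex.Im (k * binc s m)) x).
Proof. by move=> x1; apply: pseries_cvg x1 _ => m; exact: normc_Im. Qed.

Arguments Re_binc_cvg k s {x} _.
Arguments Im_binc_cvg k s {x} _.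

(** Two real power series, so that termwise differentiation on the real line applies to each. The
    scalar [k] makes the family stable under it: the derivative has coefficients
    [k * s * binc (s + 1) m]. *)
Definition binc_series (k s : R[i]) (x : R) : R[i] :=
  limn (pseries (fun m => complex.Re (k * binc s m)) x) +i*
  limn (pseries (fun m => complex.Im (k * binc s m)) x).

Lemma cvg_binc_series (k s : R[i]) (x : R) : `|x| < 1 ->
  [series k * binc s m * x%:C ^+ m]_m @ \oo --> binc_series k s x.
Proof.
move=> x1; apply: cvg_Re_Im.
  rewrite (_ : (fun _ => _) = pseries (fun m => complex.Re (k * binc s m)) x).
    exact: Re_binc_cvg.
  apply/funext => K; rewrite /pseries /series /= (raddf_sum (@complex.Re R)) /=.
  apply: eq_bigr => m _; rewrite -rmorphXn; case: (k * _) => a b /=.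
  by rewrite mulr0 subr0.
rewrite (_ : (fun _ => _) = pseries (fun m => complex.Im (k * binc s m)) x).
  exact: Im_binc_cvg.
apply/funext => K; rewrite /pseries /series /= (raddf_sum (@complex.Im R)) /=.
apply: eq_bigr => m _; rewrite -rmorphXn; case: (k * _) => a b /=.
by rewrite mulr0 add0r.
Qed.

Arguments cvg_binc_series k s {x} _.

Lemma binc_seriesM (k s : R[i]) (x : R) : `|x| < 1 ->
  binc_series k s x = k * binc_series 1 s x.
Proof.
move=> x1; apply: (@seq_cvg_unique _ [series k * binc s m * x%:C ^+ m]_m).
  exact: cvg_binc_series.
have -> : [series k * binc s m * x%:C ^+ m]_m =
    (fun K => k * series (fun m => 1 * binc s m * x%:C ^+ m) K).
  apply/funext => K; rewrite /series /= mulr_sumr; apply: eq_bigr => m _.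
  by rewrite mul1r (mulrA k (binc s m)).
exact: (cvgM (cvg_cst k) (cvg_binc_series 1 s x1)).
Qed.

Lemma binc_series_pascal (s : R[i]) (x : R) : `|x| < 1 ->
  binc_series 1 s x = (1 - x)%:C * binc_series 1 (s + 1) x.
Proof.
move=> x1.
pose S (c : R[i]) := series (fun m => 1 * binc c m * x%:C ^+ m).
have SE c k : S c k = \sum_(0 <= m < k) binc c m * x%:C ^+ m.
  by apply: eq_bigr => m _; rewrite mul1r.
have hS (c : R[i]) : S c k.+1 @[k --> \oo] --> binc_series 1 c x.
  by rewrite (cvg_shiftS (S c)); exact: cvg_binc_series.
apply: (seq_cvg_unique (hS s)); rewrite rmorphB rmorph1 mulrBl mul1r.
have -> : (fun k => S s k.+1) = (fun k => S (s + 1) k.+1 - x%:C * S (s + 1) k).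
  by apply/funext => k; rewrite !SE series_binc.
exact: (cvgB (hS (s + 1)) (cvgM (cvg_cst x%:C) (cvg_binc_series 1 (s + 1) x1))).
Qed.

(** The differential equation f' = s f / (1 - x) of (1 - x)^(-s): termwise differentiation raises s
    to s + 1, and [binc_series_pascal] brings it back at the cost of 1 - x. *)
Lemma is_derive_binc_series (s : R[i]) (x : R) : `|x| < 1 ->
  is_derive x 1 (fun x => complex.Re (binc_series 1 s x))
    (complex.Re (s * binc_series 1 s x) / (1 - x)) /\
  is_derive x 1 (fun x => complex.Im (binc_series 1 s x))
    (complex.Im (s * binc_series 1 s x) / (1 - x)).
Proof.
move=> x1; have x0 : 1 - x != 0.
  by rewrite gt_eqF // subr_gt0; exact: le_lt_trans (ler_norm x) x1.
have -> : s * binc_series 1 s x = (1 - x)%:C * binc_series s (s + 1) x.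
  by rewrite binc_series_pascal // [binc_series s _ _]binc_seriesM // mulrCA.
(* Termwise differentiation at [x] asks for convergence of the series and of its first two formal
   derivatives at a point of larger modulus. *)
have [y /andP[xy y1]] : exists y : R, `|x| < y < 1.
  by exists ((`|x| + 1) / 2); apply/andP; split; lra.
have ny : `|y| = y by rewrite ger0_norm // (le_trans (normr_ge0 x)) // ltW.
have yn : `|x| < `|y| by rewrite ny.
have y1' : `|y| < 1 by rewrite ny.
have dif (k c : R[i]) m : m.+1%:R * (k * binc c m.+1) = k * c * binc (c + 1) m :> R[i].
  by rewrite mulrCA bincS_shift mulrA.
have ReM (m : nat) z : complex.Re (m%:R * z) = m%:R * complex.Re z :> R.
  by rewrite -(rmorph_nat (real_complex R)); case: z => a b /=; rewrite mul0r subr0.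
have ImM (m : nat) z : complex.Im (m%:R * z) = m%:R * complex.Im z :> R.
  by rewrite -(rmorph_nat (real_complex R)); case: z => a b /=; rewrite mul0r addr0.
have dRe (k c : R[i]) : pseries_diffs (fun m => complex.Re (k * binc c m)) =
    (fun m => complex.Re (k * c * binc (c + 1) m)).
  by apply/funext => m; rewrite -[in RHS]dif ReM.
have dIm (k c : R[i]) : pseries_diffs (fun m => complex.Im (k * binc c m)) =
    (fun m => complex.Im (k * c * binc (c + 1) m)).
  by apply/funext => m; rewrite -[in RHS]dif ImM.
split.
  have := @pseries_snd_diffs R (fun m => complex.Re (1 * binc s m)) y x.
  rewrite !dRe mul1r => /(_ (Re_binc_cvg _ _ y1') (Re_binc_cvg _ _ y1')
    (Re_binc_cvg _ _ y1') yn) h.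
  apply: is_derive_eq h _; rewrite /binc_series /= mul0r subr0 mulrAC divff //.
  by rewrite mul1r.
have := @pseries_snd_diffs R (fun m => complex.Im (1 * binc s m)) y x.
rewrite !dIm mul1r => /(_ (Im_binc_cvg _ _ y1') (Im_binc_cvg _ _ y1')
  (Im_binc_cvg _ _ y1') yn) h.
apply: is_derive_eq h _; rewrite /binc_series /= mul0r addr0 mulrAC divff //.
by rewrite mul1r.
Qed.

Lemma derive0_ball_cst (f : R -> R) (x : R) : `|x| < 1 ->
  (forall y : R, `|y| < 1 -> is_derive y 1 f 0) -> f x = f 0.
Proof.
move=> x1 df.
suff H a b : a <= b -> `|a| < 1 -> `|b| < 1 -> f a = f b.
  have n0 : `|0 : R| < 1 by rewrite normr0.
  by have [x0|/ltW x0] := leP x 0; [exact: H|rewrite (H 0 x)].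
move=> ab; rewrite !ltr_norml => /andP[a1 a2] /andP[b1 b2].
have sub y : y \in `[a, b] -> `|y| < 1.
  rewrite in_itv /= => /andP[ay yb].
  by rewrite ltr_norml (lt_le_trans a1 ay) (le_lt_trans yb b2).
have [||c _] := @MVT_segment R f (fun=> 0) a b ab.
- by move=> y yab; apply/df/sub; exact: subset_itv_oo_cc.
- apply: continuous_in_subspaceT => y /set_mem /= yab.
  by apply/differentiable_continuous/derivable1_diffP; case: (df y (sub y yab)).
by rewrite mul0r => /eqP; rewrite subr_eq0 => /eqP ->.
Qed.

(* Both components of (1 - x)^s * sum_m (s)_(m-1) x^m have zero derivative. *)
Lemma binc_seriesE (s : R[i]) (x : R) : `|x| < 1 ->
  binc_series 1 s x = cexp (- (s * (ln (1 - x))%:C)).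
Proof.
(* The claim becomes that the series times (1 - x)^s is 1. *)
move=> x1; rewrite cexpN; apply/divr1_eq; rewrite invrK.
case: s => a b; pose s : R[i] := a +i* b; rewrite -/s.
pose U y := complex.Re (binc_series 1 s y); pose V y := complex.Im (binc_series 1 s y).
pose L (y : R) := ln (1 - y).
pose E y := expR (a * L y); pose C y := cos (b * L y); pose S y := sin (b * L y).
have E0 y : binc_series 1 s y * cexp (s * (ln (1 - y))%:C) =
    (U y * (E y * C y) - V y * (E y * S y)) +i*
    (U y * (E y * S y) + V y * (E y * C y)).
  rewrite /cexp /= !mulr0 subr0 add0r -/(L y) -/(E y) -/(C y) -/(S y) /U /V.
  by case: (binc_series _ _ _).
have dL (y : R) : `|y| < 1 -> is_derive y 1 L (- (1 - y)^-1).
  move=> y1; have y0 : 0 < 1 - y by rewrite subr_gt0; exact: le_lt_trans (ler_norm y) y1.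
  have d1 : is_derive y 1 (fun z : R => 1 - z) (-1).
    by apply: is_derive_eq; rewrite add0r mul1r.
  have := @is_derive1_comp R (@ln R) (fun z => 1 - z) y _ _ (is_derive1_ln y0) d1.
  by rewrite mulrN1.
have dlin (k y : R) : `|y| < 1 -> is_derive y 1 (fun z => k * L z) (- k / (1 - y)).
  move=> y1; have h := dL y y1; apply: is_derive_eq.
  by rewrite /GRing.scale /= mulNr mulrN.
have dE (y : R) : `|y| < 1 -> is_derive y 1 E (E y * (- a / (1 - y))).
  by move=> y1; exact: is_derive1_comp (is_derive_expR _) (dlin a y y1).
have dC (y : R) : `|y| < 1 -> is_derive y 1 C (- S y * (- b / (1 - y))).
  by move=> y1; exact: is_derive1_comp (is_derive_cos _) (dlin b y y1).
have dS (y : R) : `|y| < 1 -> is_derive y 1 S (C y * (- b / (1 - y))).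
  by move=> y1; exact: is_derive1_comp (is_derive_sin _) (dlin b y y1).
have UV (y : R) : `|y| < 1 -> is_derive y 1 U ((a * U y - b * V y) / (1 - y)) /\
    is_derive y 1 V ((a * V y + b * U y) / (1 - y)).
  move=> /(is_derive_binc_series s)[h1 h2].
  split; [apply: is_derive_eq h1 _|apply: is_derive_eq h2 _]; rewrite /U /V.
    by case: (binc_series 1 s y).
  by case: (binc_series 1 s y).
rewrite E0.
have -> : U x * (E x * C x) - V x * (E x * S x) =
    U 0 * (E 0 * C 0) - V 0 * (E 0 * S 0).
  apply: (@derive0_ball_cst (fun x => U x * (E x * C x) - V x * (E x * S x))) => // y y1.
  have h1 := dE y y1; have h2 := dC y y1; have h3 := dS y y1.
  have [h4 h5] := UV y y1.
  apply: is_derive_eq; rewrite /GRing.scale /=.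
  by move: (1 - y)^-1 => w; ring.
have -> : U x * (E x * S x) + V x * (E x * C x) =
    U 0 * (E 0 * S 0) + V 0 * (E 0 * C 0).
  apply: (@derive0_ball_cst (fun x => U x * (E x * S x) + V x * (E x * C x))) => // y y1.
  have h1 := dE y y1; have h2 := dC y y1; have h3 := dS y y1.
  have [h4 h5] := UV y y1.
  apply: is_derive_eq; rewrite /GRing.scale /=.
  by move: (1 - y)^-1 => w; ring.
rewrite -E0 subr0 ln1 mulr0 cexp0 mulr1.
have n0 : `|0 : R| < 1 by rewrite normr0.
apply: (seq_cvg_unique (cvg_binc_series 1 s n0)).
(* The shift skips the empty partial sum; all later ones equal 1, since at x = 0 only the term m = 0
   survives. *)
rewrite -cvg_shiftS /= (_ : (fun _ => _) = fun=> 1); first exact: cvg_cst.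
apply/funext => K; rewrite /series /= big_nat_recl //= binc0 !mulr1 big1 ?addr0 //.
by move=> m _; rewrite expr0n mulr0.
Qed.

Lemma cvg_binomial (s : R[i]) (x : R) : `|x| < 1 ->
  [series binc s m * x%:C ^+ m]_m @ \oo --> cexp (- (s * (ln (1 - x))%:C)).
Proof.
move=> x1; rewrite -binc_seriesE //.
have -> : [series binc s m * x%:C ^+ m]_m = [series 1 * binc s m * x%:C ^+ m]_m.
  by apply/funext => K; apply: eq_bigr => m _ /=; rewrite (mul1r (binc s m)).
exact: cvg_binc_series.
Qed.

End BinomialSeries.

(** * Domination of the Lerch series *)

Section ZetaBound.
Variable R : realType.

(** After division by x^(-eta) this is 1 + eta / x <= (1 - 1/x)^(-eta), which follows from 1 + t <=
    exp t and ln (1 - 1/x) <= - 1/x. *)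
Lemma powR_telescope (eta x : R) : 0 < eta -> 1 < x ->
  eta * x `^ (- (1 + eta)) <= (x - 1) `^ (- eta) - x `^ (- eta).
Proof.
move=> eta0 x1; have x0 : 0 < x by apply: lt_trans x1.
have y0 : 0 < 1 - x^-1 by rewrite subr_gt0 invf_lt1.
have xe : x - 1 = x * (1 - x^-1) by rewrite mulrBr mulr1 divff // gt_eqF.
have -> : (x - 1) `^ (- eta) = x `^ (- eta) * (1 - x^-1) `^ (- eta).
  by rewrite xe powRM ?ltW.
have -> : x `^ (- (1 + eta)) = x `^ (- eta) * x^-1.
  rewrite opprD addrC powRD; last by apply/implyP => _; rewrite gt_eqF.
  by rewrite powR_inv1 // ltW.
rewrite -[X in _ - X]mulr1 -mulrBr mulrCA ler_wpM2l ?powR_ge0 //.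
rewrite lerBrDl /powR gt_eqF //; apply: le_trans (expR_ge1Dx _) _.
rewrite ler_expR mulNr -mulrN ler_wpM2l ?(ltW eta0) //.
by rewrite lerNr; apply: le_ln1Dx; rewrite ltrN2 invf_lt1.
Qed.

Lemma zeta_sum_le (eta : R) N : 0 < eta ->
  \sum_(0 <= m < N) m%:R `^ (- (1 + eta)) <= 1 + eta^-1.
Proof.
move=> eta0; have i0 : 0 < eta^-1 by rewrite invr_gt0.
(* The sum starts at m = 0, where the power takes its default value 0. *)
have p0 : (0 : R) `^ (- (1 + eta)) = 0.
  by rewrite powR0 // oppr_eq0 gt_eqF // addr_gt0.
case: N => [|[|N]].
- by rewrite big_nil addr_ge0 // ltW.
- by rewrite big_nat1 p0 addr_ge0 // ltW.
(* The term m = 1 gives 1 and the others telescope; the subtracted remainder is kept to make the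
   induction work. *)
suff H : \sum_(0 <= m < N.+2) m%:R `^ (- (1 + eta)) <=
    1 + eta^-1 - eta^-1 * N.+1%:R `^ (- eta).
  by apply: le_trans H _; rewrite gerBl mulr_ge0 ?powR_ge0 // ltW.
elim: N => [|N IH].
  by rewrite !big_nat_recr //= big_nil p0 !powR1 add0r add0r mulr1 addrK.
rewrite big_nat_recr //=; apply: le_trans (lerD IH (lexx _)) _.
have : N.+2%:R `^ (- (1 + eta)) <= eta^-1 * (N.+1%:R `^ (- eta) - N.+2%:R `^ (- eta)).
  have -> : N.+1%:R = N.+2%:R - 1 :> R by rewrite -[in RHS]natr1 addrK.
  by rewrite ler_pdivlMl //; apply: powR_telescope; rewrite // ltr1n.
rewrite mulrBr; lra.
Qed.

End ZetaBound.

Lemma sum_leq_ord_max (V : nmodType) r (c : 'I_r.+1 -> V) :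
  \sum_(j < r.+1 | (j <= @ord_max r)%N) c j = \sum_j c j.
Proof. by apply: eq_bigl => j; rewrite leq_ord. Qed.

(** Induction from the last index: the partial sum before it is nonnegative, so replacing its weight
    by the smaller last weight only decreases the total. Keeping the last weight in the bound avoids
    any sign condition on [l]. *)
Lemma abel_sum_ge (R : realDomainType) r (c l : 'I_r.+1 -> R) :
  (forall i : 'I_r.+1, 0 <= \sum_(j < r.+1 | (j <= i)%N) c j) ->
  (forall i j : 'I_r.+1, (i <= j)%N -> l j <= l i) ->
  l ord_max * \sum_j c j <= \sum_j c j * l j.
Proof.
elim: r c l => [|r IH] c l c0 l_mono.
  by rewrite !big_ord_recl !big_ord0 !addr0 mulrC (_ : ord_max = ord0) //; apply: val_inj.
rewrite big_ord_recr [leRHS]big_ord_recr /= mulrDr [_ * c _]mulrC lerD2r.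
pose w := widen_ord (leqnSn r.+1).
have sumw (i : 'I_r.+1) :
    \sum_(j < r.+2 | (j <= i)%N) c j = \sum_(j < r.+1 | (j <= i)%N) c (w j).
  rewrite big_mkcond big_ord_recr /= leqNgt ltn_ord /= addr0 -big_mkcond /=.
  by apply: eq_bigr => j _; congr c; apply: val_inj.
apply: le_trans (IH (c \o w) (l \o w) _ _); last 2 first.
- by move=> i; have := c0 (w i); rewrite (sumw i).
- by move=> i j ij; exact: l_mono.
apply: ler_wpM2r; last by apply: l_mono => /=.
by have := c0 (w ord_max); rewrite (sumw ord_max) sum_leq_ord_max.
Qed.

Section Domination.
Variable R : realType.

Definition lerch_term r (lam alp : 'rV[R]_r) (s : 'rV[R[i]]_r)
    (n : {ffun 'I_r -> nat}) : R[i] :=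
  \prod_(i < r)
    (e (lam ord0 i * (n i)%:R) / cpow ((n i)%:R + alp ord0 i) (s ord0 i)).

Lemma lerchE r (lam alp : 'rV[R]_r) (s : 'rV[R[i]]_r) :
  lerch lam alp s = family_sum (decreasing_indices r) (lerch_term lam alp s).
Proof.
by congr family_sum; apply/funext => n; rewrite /lerch_term big_split prodfV.
Qed.

(** A finite set of multi-indices lies in a box, over which the sum of products is the product of
    the one-variable sums. The ordering of the indices is simply forgotten. *)
Lemma family_sum_box r (w : nat -> R) (Z : R) (D : set {ffun 'I_r -> nat}) :
  (forall m, 0 <= w m) -> (forall N, \sum_(0 <= m < N) w m <= Z) ->
  sums_bounded D (fun n => \prod_(i < r) w (n i)) (Z ^+ r).
Proof.
move=> w0 wZ B; rewrite big_seq_fsetE /=.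
pose N := \max_(x : B) \max_(i < r) val x i.
have leN (x : B) i : (val x i <= N)%N.
  by apply: leq_trans (leq_bigmax x); exact: (@leq_bigmax _ (fun i => val x i)).
pose h (x : B) : {ffun 'I_r -> 'I_N.+1} := [ffun i => inord (val x i)].
pose G (F : {ffun 'I_r -> 'I_N.+1}) := \prod_(i < r) w (F i).
have h_inj : injective h.
  move=> x y /ffunP xy; apply/val_inj/ffunP => i.
  by have /(congr1 val) := xy i; rewrite !ffunE /= !inordK // ltnS leN.
have G0 F : 0 <= G F by apply: prodr_ge0.
apply: (@le_trans _ _ (\sum_(x : B) G (h x))).
  rewrite big_mkcond; apply: ler_sum => x _; rewrite (_ : G (h x) =
    \prod_(i < r) w (val x i)); last first.
    by apply: eq_bigr => i _; rewrite ffunE inordK // ltnS leN.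
  by case: ifP => // _; apply: prodr_ge0.
have <- := @big_imset _ _ _ _ _ h predT G (in2W h_inj).
apply: (@le_trans _ _ (\sum_F G F)).
  by rewrite [leRHS](bigID (mem (h @: predT))) /= lerDl sumr_ge0.
rewrite -(bigA_distr_bigA (fun _ (j : 'I_N.+1) => w j)) /= prodr_const card_ord.
have Z0 : 0 <= Z by apply: le_trans (wZ 0%N); rewrite big_nil.
rewrite lerXn2r ?nnegrE ?sumr_ge0 //.
by have := wZ N.+1; rewrite big_mkord.
Qed.

(** The majorant is fixed before [s], so one majorant serves a whole compact set. *)
Lemma lerch_term_dominated r (alp : 'rV[R]_r.+1) (eps : R) :
  (forall i, 0 <= alp ord0 i < 1) -> 0 < eps ->
  exists (g : {ffun 'I_r.+1 -> nat} -> R) (G : R),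
    sums_bounded (decreasing_indices r.+1) g G /\
    forall (lam : 'rV[R]_r.+1) (s : 'rV[R[i]]_r.+1) n, decreasing_indices r.+1 n ->
      (forall i : 'I_r.+1,
         (i.+1)%:R + eps <= complex.Re (\sum_(j < r.+1 | (j <= i)%N) s ord0 j)) ->
      normc (lerch_term lam alp s n) <= g n.
Proof.
move=> halp eps0; pose eta := eps / r.+1%:R.
have eta0 : 0 < eta by rewrite divr_gt0.
exists (fun n => \prod_(i < r.+1) (n i)%:R `^ (- (1 + eta))), ((1 + eta^-1) ^+ r.+1).
split.
  apply: (@family_sum_box _ (fun m => m%:R `^ (- (1 + eta)))) => m.
    exact: powR_ge0.
  exact: zeta_sum_le.
move=> lam s n [n_mono n_gt0] hs.
pose x i := (n i)%:R + alp ord0 i.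
have nx i : (n i)%:R <= x i by rewrite lerDl; case/andP: (halp i).
have n1 i : 1 <= (n i)%:R :> R by rewrite ler1n.
have x1 i : 1 <= x i by apply: le_trans (nx i).
have x0 i : 0 < x i by apply: lt_le_trans (x1 i).
pose sg i := complex.Re (s ord0 i).
have -> : normc (lerch_term lam alp s n) = expR (- \sum_i sg i * ln (x i)).
  rewrite /lerch_term (big_morph _ (@normcM R) (normc1 R)) -sumrN expR_sum.
  apply: eq_bigr => i _; rewrite normcM normcV normc_e mul1r normc_cpow //.
    by rewrite -/(x i) /powR (gt_eqF (x0 i)) expRN.
  exact: x0.
have -> : \prod_(i < r.+1) (n i)%:R `^ (- (1 + eta)) =
    expR (- \sum_i (1 + eta) * ln (n i)%:R).
  rewrite -sumrN expR_sum; apply: eq_bigr => i _.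
  by rewrite /powR gt_eqF ?(lt_le_trans _ (n1 i)) // mulNr.
rewrite ler_expR lerN2.
(* The partial sums of sg j - (1 + eta) are >= eps - (i + 1) eta >= 0, and ln (x i) is
   nonnegative and nonincreasing in i, so Abel summation applies. *)
apply: (@le_trans _ _ (\sum_i (1 + eta) * ln (x i))).
  apply: ler_sum => i _; rewrite ler_wpM2l ?addr_ge0 ?(ltW eta0) //.
  by rewrite ler_ln ?posrE ?(lt_le_trans _ (n1 i)).
rewrite -subr_ge0 -sumrB; under eq_bigr do rewrite -mulrBl.
have c0 (i : 'I_r.+1) : 0 <= \sum_(j < r.+1 | (j <= i)%N) (sg j - (1 + eta)).
  rewrite sumrB sumr_const (_ : #|_| = i.+1); last first.
    rewrite -sum1_card (eq_bigl (fun j : 'I_r.+1 => (j < i.+1)%N)) //.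
    by rewrite -(big_ord_widen _ (fun=> 1%N)) // sum1_card card_ord.
  have := hs i; rewrite (raddf_sum (@complex.Re R)) /= -/sg => hsi.
  rewrite subr_ge0; apply: le_trans hsi; rewrite -[(1 + eta) *+ _]mulr_natl mulrDr mulr1 lerD2l.
  rewrite /eta mulrCA ler_piMr ?(ltW eps0) // ler_pdivrMr // mul1r ler_nat.
  exact: ltn_ord.
apply: le_trans (abel_sum_ge c0 (l := fun i => ln (x i)) _).
  apply: mulr_ge0; first exact: ln_ge0.
  by have := c0 ord_max; rewrite sum_leq_ord_max.
(* The shifts [alp] need not be monotone, but they lie in [0,1) and consecutive indices differ by at
   least 1. *)
move=> i j; rewrite leq_eqVlt => /orP[/eqP/val_inj -> //|ij].
rewrite ler_ln ?posrE //; have /andP[_ aj] := halp j; have /andP[ai _] := halp i.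
have : ((n j).+1%:R <= (n i)%:R :> R) by rewrite ler_nat n_mono.
by rewrite -natr1 /x; lra.
Qed.

End Domination.

(** * Uniformity on compact sets *)

Section NormalSummability.
Variable R : realType.

Lemma normally_summable_dominated (T : Type) (K : set T) (f : nat -> T -> R[i])
    (u : nat -> R) (U : R) : (forall m, 0 <= u m) ->
  (forall k, \sum_(0 <= m < k) u m <= U) ->
  (forall m x, K x -> normc (f m x) <= u m) -> normally_summable K f.
Proof.
move=> u0 uU fu.
have ub m : ubound [set complex.Re `|f m x| | x in K] (u m).
  by move=> _ [x Kx <-]; exact: fu.
split; first by move=> m; exists (u m).
have norm0 m : 0 <= sup_norm K (f m).
  rewrite /sup_norm; have [->|/set0P[x Kx]] := eqVneq K set0; first by rewrite image_set0 sup0.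
  apply: le_trans (normc_ge0 (f m x)) _.
  by apply: ub_le_sup; [exists (u m)|exists x].
have norm_le m : sup_norm K (f m) <= u m.
  rewrite /sup_norm; have [->|/set0P[x Kx]] := eqVneq K set0; first by rewrite image_set0 sup0.
  by apply: ge_sup (ub m); exists (complex.Re `|f m x|), x.
rewrite /summable (eq_esum (b := fun m => (sup_norm K (f m))%:E)); last first.
  by move=> m _; rewrite gee0_abs ?lee_fin.
rewrite -nneseries_esumT; last by move=> m; rewrite lee_fin.
apply: (@le_lt_trans _ _ U%:E); last exact: ltry.
apply: lime_le; first by apply: is_cvg_nneseries => m _ _; rewrite lee_fin.
apply: nearW => k; rewrite sumEFin lee_fin; apply: le_trans (uU k).
exact: ler_sum.
Qed.

(** On a nonempty compact set each of the finitely many continuous functions Re(s_1 + ... + s_i) - i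
    attains a positive minimum. *)
Lemma compact_lerch_domain r (K : set 'rV[R[i]]_r.+1) : compact K ->
  K `<=` @lerch_domain R r.+1 ->
  exists2 eps : R, 0 < eps & forall s, K s -> forall i : 'I_r.+1,
    i.+1%:R + eps <= complex.Re (\sum_(j < r.+1 | (j <= i)%N) s ord0 j).
Proof.
move=> cK Kd.
have [->|/set0P K0] := eqVneq K set0; first by exists 1.
pose f (i : 'I_r.+1) (s : 'rV[R[i]]_r.+1) :=
  complex.Re (\sum_(j < r.+1 | (j <= i)%N) s ord0 j) - i.+1%:R.
have cf i : continuous (f i).
  move=> s; have h : (fun t : 'rV[R[i]]_r.+1 => \sum_(j < r.+1 | (j <= i)%N) t ord0 j) @ s -->
      \sum_(j < r.+1 | (j <= i)%N) s ord0 j.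
    apply: (@cvg_big _ _ _ _ _ add_continuous _ (nbhs s) _ _ _ (nbhs_filter s)) => j _.
    exact: coord_continuous.
  exact: (cvgB (cvg_Re h) (cvg_cst _)).
have /choice[F HF] (i : 'I_r.+1) : exists eps : R, 0 < eps /\ forall s, K s -> eps <= f i s.
  have [c /set_mem Kc cmin] := compact_EVT_min K0 cK (continuous_subspaceT (cf i)).
  exists (f i c); split=> [|s Ks]; first by rewrite subr_gt0; exact: Kd.
  by apply: cmin; exact: mem_set.
exists (\big[Order.min/1]_i F i).
  by apply: lt_bigmin => // i _; case: (HF i).
move=> s Ks i; rewrite -lerBrDl; apply: le_trans (proj2 (HF i) s Ks).
exact: bigmin_le_cond.
Qed.

(** The bound is rounded up to a natural number because [binc_sum_le] takes a natural exponent. *)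
Lemma compact_coord_bounded r (K : set 'rV[R[i]]_r.+1) : compact K ->
  exists N : nat, forall s, K s -> normc (s ord0 ord0) <= N%:R.
Proof.
move=> cK; have [->|/set0P K0] := eqVneq K set0; first by exists 0%N.
have cf : continuous (fun s : 'rV[R[i]]_r.+1 => normc (s ord0 ord0)).
  by move=> s; exact: (cvg_normc (@coord_continuous R[i] 1 r.+1 ord0 ord0 s)).
have [c _ cmax] := compact_EVT_max K0 cK (continuous_subspaceT cf).
exists (Num.truncn (normc (c ord0 ord0))).+1 => s Ks.
apply: le_trans (cmax s (mem_set Ks)) _; exact/ltW/truncnS_gt.
Qed.

End NormalSummability.

(** * Shifting the head index *)

Section Indices.
Variable n : nat.
Implicit Types (m : {ffun 'I_n.+2 -> nat}) (p : {ffun 'I_n.+1 -> nat}).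

Definition behead_index m : {ffun 'I_n.+1 -> nat} := [ffun j => m (lift ord0 j)].

Definition succ_head m : {ffun 'I_n.+2 -> nat} :=
  [ffun i => if i == ord0 then (m i).+1 else m i].

Definition pred_head m : {ffun 'I_n.+2 -> nat} :=
  [ffun i => if i == ord0 then (m i).-1 else m i].

Definition cons_succ p : {ffun 'I_n.+2 -> nat} :=
  [ffun i => if unlift ord0 i is Some j then p j else (p ord0).+1].

Lemma ffun_head_eq m m' : m ord0 = m' ord0 -> behead_index m = behead_index m' -> m = m'.
Proof.
move=> h0 /ffunP h; apply/ffunP => i.
by case: (unliftP ord0 i) => [j|] ->; rewrite ?h0 //; have := h j; rewrite !ffunE.
Qed.

Lemma decreasing_indicesS m : decreasing_indices n.+2 m <->
  (behead_index m ord0 < m ord0)%N /\ decreasing_indices n.+1 (behead_index m).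
Proof.
split=> [[m_mono m_gt0]|[h0 [p_mono p_gt0]]].
  split; first by rewrite ffunE; exact: m_mono.
  by split=> [i j ij|i]; rewrite !ffunE //; exact: m_mono.
have le0 j : (behead_index m j <= behead_index m ord0)%N.
  have [->//|j0] := eqVneq j ord0.
  by apply/ltnW/p_mono; rewrite lt0n.
split=> [i j ij|i].
  case: (unliftP ord0 j) ij => [j'|] ->; last by rewrite ltn0.
  case: (unliftP ord0 i) => [i'|] -> ij.
    by have := p_mono i' j'; rewrite !ffunE; exact.
  by apply: leq_ltn_trans h0; have := le0 j'; rewrite !ffunE.
case: (unliftP ord0 i) => [i'|] ->; first by have := p_gt0 i'; rewrite ffunE.
exact: leq_ltn_trans h0.
Qed.

Lemma behead_succ_head m : behead_index (succ_head m) = behead_index m.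
Proof. by apply/ffunP => j; rewrite !ffunE. Qed.

Lemma behead_pred_head m : behead_index (pred_head m) = behead_index m.
Proof. by apply/ffunP => j; rewrite !ffunE. Qed.

Lemma behead_cons_succ p : behead_index (cons_succ p) = p.
Proof. by apply/ffunP => j; rewrite !ffunE liftK. Qed.

Lemma succ_head0 m : succ_head m ord0 = (m ord0).+1.
Proof. by rewrite ffunE. Qed.

Lemma pred_head0 m : pred_head m ord0 = (m ord0).-1.
Proof. by rewrite ffunE. Qed.

Lemma cons_succ0 p : cons_succ p ord0 = (p ord0).+1.
Proof. by rewrite ffunE unlift_none. Qed.

(** [succ_head] is a bijection onto the indices with n_1 > n_2 + 1, and [cons_succ] onto those with
    n_1 = n_2 + 1. *)
Lemma has_family_sum_split_head (R : realType) (A : {ffun 'I_n.+2 -> nat} -> R[i]) a b :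
  has_family_sum (decreasing_indices n.+2) (A \o succ_head) a ->
  has_family_sum (decreasing_indices n.+1) (A \o cons_succ) b ->
  has_family_sum (decreasing_indices n.+2) A (a + b).
Proof.
move=> ha hb.
pose D1 := [set m | decreasing_indices n.+2 m /\ ((behead_index m ord0).+1 < m ord0)%N].
pose D2 := [set m | decreasing_indices n.+2 m /\ m ord0 = (behead_index m ord0).+1].
have -> : decreasing_indices n.+2 = D1 `|` D2.
  apply/seteqP; split=> m; last by case=> -[].
  move=> Dm; have /decreasing_indicesS[lt _] := Dm.
  by move: lt; rewrite leq_eqVlt => /orP[/eqP e|lt]; [right|left].
apply: has_family_sumU.
- by move=> m [_ lt] [_ eq]; move: lt; rewrite eq ltnn.
- apply: (has_family_sum_reindex (h' := pred_head)) ha => m.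
    move=> Dm; have /decreasing_indicesS[lt Dp] := Dm; split.
      split; last by rewrite behead_succ_head succ_head0.
      by apply/decreasing_indicesS; rewrite behead_succ_head succ_head0; split=> //; exact: ltnW.
    by apply: ffun_head_eq; rewrite ?behead_pred_head ?behead_succ_head // pred_head0 succ_head0.
  move=> [/decreasing_indicesS[lt Dp] gap].
  have m0 : (m ord0).-1.+1 = m ord0 by case: (m ord0) lt.
  split; last first.
    by apply: ffun_head_eq; rewrite ?behead_succ_head ?behead_pred_head // succ_head0 pred_head0.
  by apply/decreasing_indicesS; rewrite behead_pred_head pred_head0 -ltnS m0.
- apply: (has_family_sum_reindex (h' := behead_index)) hb => m.
    move=> Dp; split; last exact: behead_cons_succ.
    by split; first apply/decreasing_indicesS; rewrite behead_cons_succ cons_succ0.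
  move=> [/decreasing_indicesS[lt Dp] eq]; split=> //.
  by apply: ffun_head_eq; rewrite ?behead_cons_succ // cons_succ0.
Qed.

End Indices.

(** * Single terms under changes of the head exponent *)

Section Terms.
Variable R : realType.

Lemma lerch_term_shift r (lam alp : 'rV[R]_r.+1) (s : 'rV[R[i]]_r.+1) k
    (n : {ffun 'I_r.+1 -> nat}) : 0 < (n ord0)%:R + alp ord0 ord0 ->
  lerch_term lam alp (shift_head k%:R s) n =
  lerch_term lam alp s n * (((n ord0)%:R + alp ord0 ord0)^-1)%:C ^+ k.
Proof.
move=> x0; rewrite /lerch_term !big_ord_recl /= !mxE eqxx cpowD cpow_nat //.
rewrite invfM fmorphV exprVn mulrA -!mulrA; congr (_ * (_ * _)); rewrite mulrC.
by congr (_ * _); apply: eq_bigr => i _; rewrite !mxE.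
Qed.

Lemma lerch_term_behead n (lam alp : 'rV[R]_n.+2) (s : 'rV[R[i]]_n.+2) m :
  lerch_term lam alp s m =
  e (lam ord0 ord0 * (m ord0)%:R) / cpow ((m ord0)%:R + alp ord0 ord0) (s ord0 ord0) *
  lerch_term (drop_head lam) (drop_head alp) (drop_head s) (behead_index m).
Proof.
rewrite /lerch_term big_ord_recl; congr (_ * _).
by apply: eq_bigr => i _; rewrite !mxE !ffunE.
Qed.

Lemma lerch_term_merge n (lam alp : 'rV[R]_n.+2) (s : 'rV[R[i]]_n.+2) p :
  lerch_term (merge_head lam) (drop_head alp) (merge_head s) p =
  e (lam ord0 ord0 * (p ord0)%:R) /
    cpow ((p ord0)%:R + alp ord0 (lift ord0 ord0)) (s ord0 ord0) *
  lerch_term (drop_head lam) (drop_head alp) (drop_head s) p.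
Proof.
rewrite /lerch_term !big_ord_recl !mxE eqxx cpowD mulrDl eD invfM.
rewrite [RHS]mulrA [e _ * e _ * _]mulrACA; congr (_ * _).
by apply: eq_bigr => i _; rewrite !mxE.
Qed.

Lemma sum_merge_head (V : zmodType) n (v : 'rV[V]_n.+2) (i : 'I_n.+1) :
  \sum_(j < n.+1 | (j <= i)%N) merge_head v ord0 j =
  \sum_(j < n.+2 | (j <= lift ord0 i)%N) v ord0 j.
Proof.
rewrite big_mkcond [RHS]big_mkcond !big_ord_recl /= !mxE eqxx addrA; congr (_ + _).
by apply: eq_bigr => j _; rewrite !mxE.
Qed.

(** Turns the sum of a binomial series back into a power: for y = c / x the new base is x - c, that
    is n_1 - 1 + alpha_1 on the right and n_2 + alpha_1 on the left. *)
Lemma cpow_binomial (x y : R) (s : R[i]) : 0 < x -> 0 < 1 - y ->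
  (cpow x s)^-1 * cexp (- (s * (ln (1 - y))%:C)) = (cpow (x * (1 - y)) s)^-1.
Proof.
move=> x0 y0; rewrite /cpow -!cexpN -cexpD; congr cexp.
by rewrite lnM ?posrE // rmorphD mulrDr opprD.
Qed.

End Terms.

(** * Binomial series of Lerch values with shifted head exponent *)

Section ShiftSeries.
Variables (R : realType) (r : nat) (lam alp : 'rV[R]_r.+1) (s : 'rV[R[i]]_r.+1).
Variables (g : {ffun 'I_r.+1 -> nat} -> R) (G c delta : R).
Hypothesis gG : sums_bounded (decreasing_indices r.+1) g G.
Hypothesis term_g : forall n, decreasing_indices r.+1 n -> normc (lerch_term lam alp s n) <= g n.
Hypothesis alp_ge0 : 0 <= alp ord0 ord0.
Let y (n : {ffun 'I_r.+1 -> nat}) := c / ((n ord0)%:R + alp ord0 ord0).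
Hypothesis y_le : forall n, decreasing_indices r.+1 n -> `|y n| <= delta.
Hypothesis delta01 : 0 <= delta < 1.

Lemma shift_family_sum k :
  has_family_sum (decreasing_indices r.+1)
    (fun n => lerch_term lam alp s n * (y n)%:C ^+ k)
    (c%:C ^+ k * lerch lam alp (shift_head k%:R s)) /\
  normc (c%:C ^+ k * lerch lam alp (shift_head k%:R s)) <= G * delta ^+ k.
Proof.
have /andP[d0 d1] := delta01.
have x0 n : decreasing_indices r.+1 n -> 0 < (n ord0)%:R + alp ord0 ord0.
  by case=> _ /(_ ord0) n0; rewrite ltr_wpDr // ltr0n.
have bnd m : sums_bounded (decreasing_indices r.+1) (fun n => g n * delta ^+ m) (G * delta ^+ m).
  by move=> B; rewrite -mulr_suml ler_wpM2r ?exprn_ge0.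
have le m n : decreasing_indices r.+1 n ->
    normc (lerch_term lam alp s n * (y n)%:C ^+ m) <= g n * delta ^+ m.
  move=> Dn; rewrite normcM normcX normc_real ler_pM ?normc_ge0 ?exprn_ge0 //.
    exact: term_g.
  by rewrite lerXn2r ?nnegrE ?y_le.
suff h : has_family_sum (decreasing_indices r.+1)
    (fun n => lerch_term lam alp s n * (y n)%:C ^+ k)
    (c%:C ^+ k * lerch lam alp (shift_head k%:R s)).
  by split=> //; exact: (has_family_sum_le (le k) (bnd k) h).
(* The shifted Lerch series is summed on its own, as the head base is at least 1. Its convergence
   could not be recovered from the family with [y n] when [c] is 0, i.e. when alpha_1 = alpha_2 on
   the left. *)
have xk n : decreasing_indices r.+1 n ->
    normc (lerch_term lam alp (shift_head k%:R s) n) <= g n.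
  move=> Dn; rewrite lerch_term_shift ?x0 // normcM normcX normc_real.
  apply: le_trans (term_g Dn); rewrite ler_piMr ?normc_ge0 // exprn_ile1 // ger0_norm ?invr_ge0 ?(ltW (x0 _ Dn)) //.
  by rewrite invf_le1 ?x0 // ler_wpDr // ler1n; case: Dn => _; exact.
have [l hl] := has_family_sum_dominated xk gG.
rewrite lerchE (family_sumE hl).
refine (eq_has_family_sum _ (has_family_sumMl (c%:C ^+ k) hl)) => n /set_mem Dn.
rewrite lerch_term_shift ?x0 // /y rmorphM exprMn; ring.
Qed.

Lemma shift_series_cvg (sig : R[i]) (N : nat) : normc sig <= N%:R ->
  exists2 L, has_family_sum (decreasing_indices r.+1)
      (fun n => lerch_term lam alp s n * cexp (- (sig * (ln (1 - y n))%:C))) L &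
    [series binc sig k * (c%:C ^+ k * lerch lam alp (shift_head k%:R s))]_k @ \oo --> L.
Proof.
move=> sN.
apply: (exchange_series_family_sum gG term_g y_le (q := binc N%:R)
  (U := (1 - delta) ^- N)).
- by move=> m; exact: normc_binc.
- by move=> K; exact: binc_sum_le.
- move=> n Dn; apply: cvg_binomial.
  by case/andP: delta01 => _; apply: le_lt_trans; exact: y_le.
- by move=> k; have [] := shift_family_sum k.
Qed.

End ShiftSeries.

(** * The translation formula *)

Section Translation.
Variables (R : realType) (n : nat) (lam alp : 'rV[R]_n.+2).
Hypothesis halp : forall i : 'I_n.+2, 0 <= alp ord0 i < 1.

Let c := alp ord0 (lift ord0 ord0) - alp ord0 ord0.

(** This is where depth at least 2 enters: it keeps 1 / (n_1 + alpha_1) away from 1, the boundary of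
    convergence of the binomial series. *)
Lemma head_index_ge2 m : decreasing_indices n.+2 m -> (2 <= m ord0)%N.
Proof.
by case=> m_mono /(_ (lift ord0 ord0)) m1; apply: leq_ltn_trans m1 _; exact: m_mono.
Qed.

Lemma head_ratio_le m : decreasing_indices n.+2 m ->
  `|1 / ((m ord0)%:R + alp ord0 ord0)| <= 2^-1.
Proof.
move=> /head_index_ge2 m2; have /andP[a0 _] := halp ord0.
have x2 : 2 <= (m ord0)%:R + alp ord0 ord0 by rewrite ler_wpDr // ler_nat.
have x0 : 0 < (m ord0)%:R + alp ord0 ord0 by apply: lt_le_trans x2.
by rewrite div1r ger0_norm ?invr_ge0 ?(ltW x0) // lef_pV2 ?posrE.
Qed.

Lemma shift_ratio_lt1 : 0 <= `|c| < 1.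
Proof.
rewrite normr_ge0 ltr_norml /c.
have /andP[a0 a1] := halp ord0; have /andP[b0 b1] := halp (lift ord0 ord0).
by apply/andP; split; lra.
Qed.

Lemma shift_ratio_le p : decreasing_indices n.+1 p ->
  `|c / ((p ord0)%:R + drop_head alp ord0 ord0)| <= `|c|.
Proof.
move=> [_ /(_ ord0) p0]; rewrite mxE; have /andP[a0 _] := halp (lift ord0 ord0).
have x1 : 1 <= (p ord0)%:R + alp ord0 (lift ord0 ord0) by rewrite ler_wpDr // ler1n.
have x0 : 0 < (p ord0)%:R + alp ord0 (lift ord0 ord0) by apply: lt_le_trans x1.
by rewrite normrM ler_piMr // ger0_norm ?invr_ge0 ?(ltW x0) // invf_le1.
Qed.

Lemma half01 : 0 <= (2^-1 : R) < 1.
Proof. by rewrite invr_ge0 ler0n invf_lt1 ?ltr1n. Qed.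

Lemma lhs_termE m (s : 'rV[R[i]]_n.+2) : lhs_term lam alp m s =
  binc (s ord0 ord0) m *
  (c%:C ^+ m * lerch (merge_head lam) (drop_head alp) (shift_head m%:R (merge_head s))).
Proof. by rewrite /lhs_term poch_binc rmorphXn mulrA. Qed.

(** The factor 1^(k+1) is spelled out to match [shift_series_cvg] with c = 1; the series on the
    right is that one without its term of index 0. *)
Lemma rhs_termE k (s : 'rV[R[i]]_n.+2) : rhs_term lam alp k s =
  binc (s ord0 ord0) k.+1 * ((1 : R)%:C ^+ k.+1 * lerch lam alp (shift_head k.+1%:R s)).
Proof. by rewrite rmorph1 expr1n mul1r. Qed.

Lemma compact_domination (K : set 'rV[R[i]]_n.+2) :
  compact K -> K `<=` @lerch_domain R n.+2 ->
  exists g G g' G' (N : nat),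
    [/\ sums_bounded (decreasing_indices n.+2) g G,
        sums_bounded (decreasing_indices n.+1) g' G' &
        forall s, K s -> [/\ normc (s ord0 ord0) <= N%:R,
          forall m, decreasing_indices n.+2 m -> normc (lerch_term lam alp s m) <= g m &
          forall p, decreasing_indices n.+1 p ->
            normc (lerch_term (merge_head lam) (drop_head alp) (merge_head s) p) <= g' p]].
Proof.
move=> cK Kd; have [eps eps0 Keps] := compact_lerch_domain cK Kd.
have [N KN] := compact_coord_bounded cK.
have [g [G [gG gP]]] := lerch_term_dominated halp eps0.
have halp' i : 0 <= drop_head alp ord0 i < 1 by rewrite mxE.
have [g' [G' [g'G' g'P]]] := lerch_term_dominated halp' eps0.
exists g, G, g', G', N; split=> // s Ks; split; first exact: KN.
  by move=> m Dm; apply: gP => // i; exact: Keps.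
(* A partial sum of the merged exponents contains one more original exponent, so its lower bound
   exceeds the required one by 1. *)
move=> p Dp; apply: g'P => // i; rewrite sum_merge_head.
by apply: le_trans (Keps s Ks (lift ord0 i)); rewrite lerD2r ler_nat.
Qed.

Lemma translation_formula (s : 'rV[R[i]]_n.+2) : @lerch_domain R n.+2 s ->
  e (lam ord0 ord0) * limn [series lhs_term lam alp m s]_m
  = (1 - e (lam ord0 ord0)) * lerch lam alp s
    + limn [series rhs_term lam alp k s]_k.
Proof.
(* The pointwise formula uses the uniform bounds on the compact set {s}. *)
move=> sd; have [|g [G [g' [G' [N [gG gG' H]]]]]] := compact_domination (@compact_set1 _ s).
  by move=> _ ->.
have [sN tg tg'] := H s erefl.
have /andP[a0 _] := halp ord0; have /andP[a1 _] := halp (lift ord0 ord0).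
have a1' : 0 <= drop_head alp ord0 ord0 by rewrite mxE.
have [LA hA cA] := shift_series_cvg gG tg a0 head_ratio_le half01 sN.
have [LB hB cB] := shift_series_cvg gG' tg' a1' shift_ratio_le shift_ratio_lt1 sN.
have [L hL] := has_family_sum_dominated tg gG.
have lerchL : lerch lam alp s = L by rewrite lerchE; exact: family_sumE.
pose A (m : {ffun 'I_n.+2 -> nat}) := e (lam ord0 ord0 * (m ord0)%:R) /
  cpow ((m ord0)%:R - 1 + alp ord0 ord0) (s ord0 ord0) *
  lerch_term (drop_head lam) (drop_head alp) (drop_head s) (behead_index m).
have AS (m : {ffun 'I_n.+2 -> nat}) k : m ord0 = k.+1 ->
    A m = e (lam ord0 ord0) * (e (lam ord0 ord0 * k%:R) /
      cpow (k%:R + alp ord0 ord0) (s ord0 ord0) *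
      lerch_term (drop_head lam) (drop_head alp) (drop_head s) (behead_index m)).
  by move=> mk; rewrite /A mk -natr1 addrK mulrDr mulr1 addrC eD !mulrA.
(* First evaluation of the sum of A: termwise, the binomial series in 1 / (n_1 + alpha_1) replaces
   the head base x by x - 1. *)
have hA' : has_family_sum (decreasing_indices n.+2) A LA.
  refine (eq_has_family_sum _ hA) => m /set_mem Dm.
  have := head_ratio_le Dm; rewrite lerch_term_behead /A.
  have x0 : 0 < (m ord0)%:R + alp ord0 ord0.
    by rewrite ltr_wpDr // ltr0n; exact: leq_trans (head_index_ge2 Dm).
  set x := (m ord0)%:R + alp ord0 ord0 in x0 *; rewrite ler_norml => /andP[_ y2].
  rewrite (_ : (m ord0)%:R - 1 + alp ord0 ord0 = x * (1 - 1 / x)); last first.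
    by rewrite mulrBr mulr1 mulrCA divff ?gt_eqF // /x; ring.
  have y1 : 0 < 1 - 1 / x by rewrite subr_gt0 (le_lt_trans y2) //; case/andP: half01.
  have E := cpow_binomial (s ord0 ord0) x0 y1.
  by rewrite -E mulrAC !mulrA.
have hS : has_family_sum (decreasing_indices n.+2) (A \o @succ_head n)
    (e (lam ord0 ord0) * L).
  refine (eq_has_family_sum _ (has_family_sumMl (e (lam ord0 ord0)) hL)) => m _.
  by rewrite /= (AS _ _ (succ_head0 m)) behead_succ_head -lerch_term_behead.
have hC : has_family_sum (decreasing_indices n.+1) (A \o @cons_succ n)
    (e (lam ord0 ord0) * LB).
  refine (eq_has_family_sum _ (has_family_sumMl (e (lam ord0 ord0)) hB)) => p /set_mem Dp.
  rewrite /= (AS _ _ (cons_succ0 p)) behead_cons_succ lerch_term_merge mxE.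
  congr (_ * _).
  have x0 : 0 < (p ord0)%:R + alp ord0 (lift ord0 ord0).
    by rewrite ltr_wpDr // ltr0n; case: Dp.
  have := shift_ratio_le Dp; rewrite mxE.
  set x := (p ord0)%:R + alp ord0 (lift ord0 ord0) in x0 *.
  rewrite ler_norml => /andP[_ y1].
  rewrite (_ : (p ord0)%:R + alp ord0 ord0 = x * (1 - c / x)); last first.
    by rewrite mulrBr mulr1 mulrCA divff ?gt_eqF // /x /c; ring.
  have y0 : 0 < 1 - c / x by rewrite subr_gt0 (le_lt_trans y1) //; case/andP: shift_ratio_lt1.
  have E := cpow_binomial (s ord0 ord0) x0 y0.
  by rewrite -E mulrAC !mulrA.
(* Second evaluation, by the splitting of the indices, compared with the first. *)
have LAE : LA = e (lam ord0 ord0) * L + e (lam ord0 ord0) * LB.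
  by rewrite -(family_sumE hA') (family_sumE (has_family_sum_split_head hS hC)).
have -> : limn [series lhs_term lam alp m s]_m = LB.
  have -> : (fun m => lhs_term lam alp m s) = (fun m => binc (s ord0 ord0) m * (c%:C ^+ m *
      lerch (merge_head lam) (drop_head alp) (shift_head m%:R (merge_head s)))).
    by apply/funext => m; exact: lhs_termE.
  exact: (cvg_lim (@norm_hausdorff _ R[i]) cB).
(* The full series [u] has sum [LA]; its term of index 0, absent from the series on the right, is
   the Lerch value [L]. *)
have -> : limn [series rhs_term lam alp k s]_k = LA - L.
  pose u k := binc (s ord0 ord0) k * ((1 : R)%:C ^+ k * lerch lam alp (shift_head k%:R s)).
  have u0 : u 0%N = L.
    rewrite /u binc0 expr0 !mul1r -lerchL; congr lerch.
    by apply/rowP => i; rewrite mxE addr0; case: eqP.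
  have -> : [series rhs_term lam alp k s]_k = (fun K => series u K.+1 - L).
    apply/funext => K; rewrite /series /= [X in _ = X - _]big_nat_recl //= u0.
    rewrite addrC addKr.
    by apply: eq_bigr => k _; exact: rhs_termE.
  have cA' : series u K.+1 @[K --> \oo] --> LA.
    rewrite (cvg_shiftS (series u)).
    exact: cA.
  have cAB : (fun K => series u K.+1 - L) @ \oo --> LA - L.
    exact: (cvgB cA' (cvg_cst L)).
  exact: (cvg_lim (@norm_hausdorff _ R[i]) cAB).
by rewrite lerchL LAE; move: (e (lam ord0 ord0)) => z; ring.
Qed.

Lemma translation_normally_summable (K : set 'rV[R[i]]_n.+2) :
  compact K -> K `<=` @lerch_domain R n.+2 ->
  normally_summable K (lhs_term lam alp) /\ normally_summable K (rhs_term lam alp).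
Proof.
move=> cK Kd; have [g [G [g' [G' [N [gG gG' H]]]]]] := compact_domination cK Kd.
have /andP[a0 _] := halp ord0.
have a1' : 0 <= drop_head alp ord0 ord0 by rewrite mxE; case/andP: (halp (lift ord0 ord0)).
(* The empty finite set already shows that the bounds are nonnegative. *)
have G0 : 0 <= G by have := gG fset0; rewrite big_mkcond big_seq_fset0.
have G'0 : 0 <= G' by have := gG' fset0; rewrite big_mkcond big_seq_fset0.
have b0 k : 0 <= binc (N%:R : R) k by exact: binc_ge0.
split.
  apply: (@normally_summable_dominated _ _ _ _
    (fun m => binc N%:R m * (G' * `|c| ^+ m)) (G' * (1 - `|c|) ^- N)).
  - by move=> m; rewrite mulr_ge0 // mulr_ge0 // exprn_ge0.
  - move=> k; under eq_bigr do rewrite mulrCA.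
    by rewrite -mulr_sumr ler_wpM2l // binc_sum_le // shift_ratio_lt1.
  - move=> m s Ks; have [sN _ tg'] := H s Ks.
    rewrite lhs_termE normcM ler_pM ?normc_ge0 ?normc_binc //.
    by have [] := shift_family_sum gG' tg' a1' shift_ratio_le shift_ratio_lt1 m.
apply: (@normally_summable_dominated _ _ _ _
  (fun k => binc N%:R k.+1 * (G * 2^-1 ^+ k.+1)) (G * (1 - 2^-1) ^- N)).
- by move=> m; rewrite mulr_ge0 // mulr_ge0 // exprn_ge0 // invr_ge0.
- move=> k; under eq_bigr do rewrite mulrCA.
  rewrite -mulr_sumr ler_wpM2l //; apply: le_trans (binc_sum_le N k.+1 half01).
  (* The majorant series starts at exponent 1; restoring its term 1 of exponent 0 only increases the
     sum. *)
  by rewrite [leRHS]big_nat_recl // lerDr binc0 expr0 mulr1.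
- move=> k s Ks; have [sN tg _] := H s Ks.
  rewrite rhs_termE normcM ler_pM ?normc_ge0 ?normc_binc //.
  by have [] := shift_family_sum gG tg a0 head_ratio_le half01 k.+1.
Qed.

End Translation.

Theorem theorem4 (R : realType) (n : nat) (lam alp : 'rV[R]_n.+2)
  (hlam : forall i : 'I_n.+2, 0 <= lam ord0 i < 1)
  (halp : forall i : 'I_n.+2, 0 <= alp ord0 i < 1) :
  (forall s : 'rV[R[i]]_n.+2, lerch_domain n.+2 s ->
     e (lam ord0 ord0) * limn [series lhs_term lam alp m s]_m
     = (1 - e (lam ord0 ord0)) * lerch lam alp s
       + limn [series rhs_term lam alp k s]_k) /\
  (forall K : set 'rV[R[i]]_n.+2, compact K -> K `<=` lerch_domain n.+2 ->
     normally_summable K (lhs_term lam alp) /\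
     normally_summable K (rhs_term lam alp)).
Proof.
split=> [s|K]; first exact: translation_formula.
exact: translation_normally_summable.
Qed.
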